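(* Let $\mathcal T=(T_t)_{t>0}$ be a 2-positive and contractive analytic semigroup acting on a von Neumann algebra $\mathcal M$ and let $\alpha>0$. Then $$\mathcal L^c_\alpha(\mathcal T)=\mathcal L^r_\alpha(\mathcal T)=\mathcal L^{cr}_\alpha(\mathcal T)$$ as subspaces of $\mathcal M$, with equivalent norms.
   Context: Let $\mathcal M$ be a von Neumann algebra with operator norm $\|\cdot\|_\infty$ and predual $L^1(\mathcal M)$; $|x|^2=x^*x$; $[\alpha]$ is the integer part of $\alpha$; $I$ is the identity map on $\mathcal M$. A family of linear operators $\mathcal T=(T_t)_{t>0}$ on $\mathcal M$ is a semigroup if $T_0=\mathrm{id}$ and $T_tT_s=T_{t+s}$ for $s,t>0$. It is called 2-positive and contractive if (i) each $T_t$ is 2-positive, i.e. $\mathrm{id}_{M_2}\otimes T_t$ is positive on $M_2\otimes\mathcal M$ ($M_2$ being the $2\times2$ complex matrices); (ii) $\|T_tf\|_\infty\le\|f\|_\infty$ for all $t>0$, $f\in\mathcal M$; (iii) for every $f\in\mathcal M$, $T_tf\to f$ in the weak-$*$ topology as $t\to0^+$. Such a semigroup is called analytic if there is $\delta\in(0,\pi/2)$ such that $(T_t)_{t>0}$ extends to a bounded map $z\in\Sigma_\delta\mapsto T_z\in B(\mathcal M)$, where $\Sigma_\delta=\{z\in\mathbb C\setminus\{0\}:|\mathrm{Arg}(z)|<\delta\}$, with $z\mapsto\langle T_zx,\varphi\rangle$ holomorphic on $\Sigma_\delta$ for all $x\in\mathcal M$, $\varphi\in L^1(\mathcal M)$.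 The column Campanato space $\mathcal L^c_\alpha(\mathcal T)$ is the space of $f\in\mathcal M$ with $$\|f\|_{\mathcal L^c_\alpha(\mathcal T)}=\|f\|_\infty+\sup_{t>0}\frac1{t^\alpha}\left\|T_t\left|(I-T_t)^{[\alpha]+1}f\right|^2\right\|_\infty^{1/2}<\infty .$$ The row space $\mathcal L^r_\alpha(\mathcal T)$ is the space of $f\in\mathcal M$ with $f^*\in\mathcal L^c_\alpha(\mathcal T)$, normed by $\|f\|_{\mathcal L^r_\alpha(\mathcal T)}=\|f^*\|_{\mathcal L^c_\alpha(\mathcal T)}$. The mixture space is $\mathcal L^{cr}_\alpha(\mathcal T)=\mathcal L^c_\alpha(\mathcal T)\cap\mathcal L^r_\alpha(\mathcal T)$ with the intersection norm (the maximum of the two norms). Equivalence of norms means two-sided bounds with positive constants not depending on $f$. *)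

(* Defs.v *)
From HB Require Import structures.
From mathcomp Require Import all_boot all_order all_algebra.
From mathcomp Require Import complex.
From mathcomp Require Import all_classical all_reals all_analysis.

Set Implicit Arguments.
Unset Strict Implicit.
Unset Printing Implicit Defensive.

Import Order.TTheory GRing.Theory Num.Theory.
Import numFieldNormedType.Exports.

Local Open Scope classical_set_scope.
Local Open Scope ring_scope.
Local Open Scope complex_scope.

(* The form [ip] is linear in its first argument and conjugate-linear in its
   second one. *)
Record hilbert (R : realType) := Hilbert {
  hilbert_sort :> completeNormedModType R[i] ;
  ip : {dot hilbert_sort for Num.conj} ;
  ip_norm : forall u : hilbert_sort, `|u| ^+ 2 = ip u u }.

Section Operators.
Context {R : realType} {H : hilbert R}.
Implicit Types (x y f : H -> H) (M : set (H -> H)).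

(* The library norm of a complex normed module takes its (real) values in
   [R[i]]. *)
Definition hnorm (u : H) : R := complex.Re `|u|.

Definition bounded_op : set (H -> H) := [set x | linear x /\ continuous x].

Definition opnorm x : R := sup [set hnorm (x u) | u in [set u | hnorm u <= 1]].

Definition is_adjoint x y := forall u v : H, ip H (x u) v = ip H u (y v).

(* [adj x] is [x^*]; the default value [0] is only taken by maps that have no
   adjoint, hence by no element of a von Neumann algebra. *)
Definition adj x : H -> H := xget (fun=> 0) [set y | is_adjoint x y].

Lemma is_adjoint_inj x y y' : is_adjoint x y -> is_adjoint x y' -> y = y'.
Proof.
move=> xy xy'; apply/funext => v; apply/eqP; rewrite -subr_eq0 -normr_eq0.
by rewrite -sqrf_eq0 ip_norm linearBr /= -xy -xy' subrr.
Qed.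

Lemma adjE x y : is_adjoint x y -> adj x = y.
Proof. by move=> xy; apply: is_adjoint_inj (xy); apply: (xgetPex _ (ex_intro _ y xy)). Qed.

Definition commutant (S : set (H -> H)) : set (H -> H) :=
  [set y | bounded_op y /\ forall x, S x -> x \o y = y \o x].

Definition von_neumann_algebra M : Prop :=
  [/\ M `<=` bounded_op,
      forall x, M x -> exists2 y, M y & is_adjoint x y &
      commutant (commutant M) = M].

(* The ultraweakly continuous linear functionals on [M], written as
   x |-> \sum_n <x (xi n), eta n> with square-summable xi, eta. Functionals are
   total functions of which only the values on [M] matter. The topology of the
   complex field is attached to [R[i]^o]. *)
Definition predual M : set ((H -> H) -> R[i]^o) :=
  [set phi : (H -> H) -> R[i]^o | exists xi eta : nat -> H,
    [/\ cvgn (series (fun n => hnorm (xi n) ^+ 2)),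
        cvgn (series (fun n => hnorm (eta n) ^+ 2)) &
        forall x, M x ->
          series (fun n => ip H (x (xi n)) (eta n) : R[i]^o) @ \oo --> phi x]].

(* Linear maps of [M] into itself; the values outside [M] are irrelevant. *)
Definition endo_linear M (S : (H -> H) -> (H -> H)) : Prop :=
  (forall x, M x -> M (S x)) /\
  (forall (a : R[i]) x y, M x -> M y -> S (a *: x + y) = a *: S x + S y).

(* Positivity of the operator matrix [X] acting on the direct sum of [n] copies
   of [H]. *)
Definition positive_mx n (X : 'M[H -> H]_n) : Prop :=
  forall u : 'I_n -> H, 0 <= \sum_i \sum_j ip H (X i j (u j)) (u i).

(* The map (id \otimes S) on M_n \otimes M = M_n(M) applies [S] entrywise. *)
Definition npositive M n (S : (H -> H) -> (H -> H)) : Prop :=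
  forall X : 'M[H -> H]_n, (forall i j, M (X i j)) ->
    positive_mx X -> positive_mx (map_mx S X).

Definition op_semigroup M (T : R -> (H -> H) -> (H -> H)) : Prop :=
  [/\ forall t, 0 < t -> endo_linear M (T t),
      forall x, M x -> T 0 x = x &
      forall s t, 0 < s -> 0 < t -> forall x, M x -> T t (T s x) = T (t + s) x].

Definition two_positive_contractive M (T : R -> (H -> H) -> (H -> H)) : Prop :=
  [/\ forall t, 0 < t -> npositive M 2 (T t),
      forall t f, 0 < t -> M f -> opnorm (T t f) <= opnorm f &
      forall f phi, M f -> predual M phi ->
        (fun t : R => phi (T t f)) @ 0^'+ --> phi f].

(* The principal argument, with values in ]-pi, pi] for z != 0. *)
Definition Arg (z : R[i]) : R :=
  let theta := acos (complex.Re z / complex.Re `|z|) in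
  if 0 <= complex.Im z then theta else - theta.

Definition sector (delta : R) : set R[i] :=
  [set z | z != 0 /\ `|Arg z| < delta].

Definition analytic_semigroup M (T : R -> (H -> H) -> (H -> H)) : Prop :=
  exists delta : R, exists Tz : R[i] -> (H -> H) -> (H -> H),
  [/\ 0 < delta < pi / 2,
      forall t x, 0 < t -> M x -> Tz t%:C x = T t x,
      forall z, sector delta z -> endo_linear M (Tz z),
      exists C : R, forall z x, sector delta z -> M x ->
        opnorm (Tz z x) <= C * opnorm x &
      forall x phi, M x -> predual M phi -> forall z, sector delta z ->
        derivable (fun w : R[i]^o => phi (Tz w x)) z 1].

Section Campanato.
Variables (M : set (H -> H)) (T : R -> (H -> H) -> (H -> H)) (alpha : R).

Definition abs_sq x : H -> H := adj x \o x.

(* [Num.truncn alpha] is the integer part of alpha >= 0. *)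
Definition campanato_osc (t : R) f : R :=
  (t `^ alpha)^-1 *
  Num.sqrt (opnorm
    (T t (abs_sq (iter (Num.truncn alpha).+1 (fun x => x - T t x) f)))).

Definition col_norm f : \bar R :=
  ((opnorm f)%:E +
   ereal_sup [set (campanato_osc t f)%:E | t in [set t | (0 < t)%R]])%E.

Definition row_norm f : \bar R := col_norm (adj f).

Definition mix_norm f : \bar R := maxe (col_norm f) (row_norm f).

Definition col_space : set (H -> H) := [set f | M f /\ (col_norm f < +oo)%E].

Definition row_space : set (H -> H) := [set f | M f /\ col_space (adj f)].

Definition mix_space : set (H -> H) := col_space `&` row_space.

End Campanato.

Definition equivalent_norms (D : set (H -> H)) (N1 N2 : (H -> H) -> \bar R) :
    Prop :=
  exists C1 C2 : R, [/\ 0 < C1, 0 < C2 &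
    forall f, D f -> (C1%:E * N1 f <= N2 f)%E /\ (N2 f <= C2%:E * N1 f)%E].

End Operators.

(* Main.v *)
(* Write [k = [alpha] + 1] and [D_s = I - T_s]. Both norms are equivalent to the
   *-invariant one with oscillation [t^-alpha ||D_t^k f||]. One bound is
   contractivity: [||T_t |x|^2|| <= ||x||^2]. For the other, let [A] bound the
   column oscillation; the Kadison-Schwarz inequality
   [|T_s x|^2 <= T_s |x|^2] gives [||T_s D_s^k f|| <= A s^alpha]. Since
   [D_2s = (I + T_s) D_s], the difference [D_2s^k f - D_s^k f] is a combination
   of images of [T_s D_s^k f] under contractions, hence is [O(A s^alpha)].
   Summing over [s = t / 2^n], [n >= 1], bounds [D_t^k f - D_(t / 2^n)^k f]
   uniformly in [n], and [D_(t / 2^n)^k f] tends weak-* to [0]. *)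

Require Import Defs.
From HB Require Import structures.
From mathcomp Require Import all_boot all_order all_algebra.
From mathcomp Require Import complex.
From mathcomp Require Import all_classical all_reals all_analysis.
From mathcomp Require Import ring lra.

Set Implicit Arguments.
Unset Strict Implicit.
Unset Printing Implicit Defensive.

Import Order.TTheory GRing.Theory Num.Theory.
Import numFieldNormedType.Exports.

Local Open Scope classical_set_scope.
Local Open Scope ring_scope.
Local Open Scope complex_scope.

(** * Norm and inner product of the Hilbert space *)

Lemma ReD (R : realType) (a b : R[i]) : complex.Re (a + b) = complex.Re a + complex.Re b.
Proof. by case: a b => [? ?] [? ?]. Qed.

Section HilbertNorm.
Context {R : realType} {H : hilbert R}.
Implicit Types (u v w : H) (x y : H -> H).

Lemma normC_hnorm u : `|u| = (hnorm u)%:C.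
Proof. by rewrite /hnorm RRe_real// ger0_real. Qed.

Lemma hnorm_ge0 u : 0 <= hnorm u.
Proof. by rewrite -ler0c -normC_hnorm. Qed.

Lemma hnorm0 : hnorm (0 : H) = 0.
Proof. by rewrite /hnorm normr0. Qed.

Lemma hnorm_eq0 u : hnorm u = 0 -> u = 0.
Proof. by move=> u0; apply/eqP; rewrite -normr_eq0 normC_hnorm u0. Qed.

Lemma hnormZ (a : R) u : hnorm (a%:C *: u) = `|a| * hnorm u.
Proof.
apply: complexI; rewrite -normC_hnorm normrZ rmorphM normC_hnorm; congr (_ * _).
by rewrite normc_def /= expr0n addr0 sqrtr_sqr.
Qed.

Lemma hnormD u v : hnorm (u + v) <= hnorm u + hnorm v.
Proof. by rewrite -lecR -normC_hnorm (le_trans (ler_normD u v))// !normC_hnorm rmorphD. Qed.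

Lemma ip_hnorm u : ip H u u = (hnorm u ^+ 2)%:C.
Proof. by rewrite -ip_norm normC_hnorm rmorphXn. Qed.

Lemma ip_conj u v : ip H u v = (ip H v u)^*%C.
Proof. by rewrite hermC /= expr0 mul1r. Qed.

Lemma Re_ipC u v : complex.Re (ip H u v) = complex.Re (ip H v u).
Proof. by rewrite ip_conj; case: (ip H v u). Qed.

Lemma hnormD_sqr u v :
  hnorm (u + v) ^+ 2 = hnorm u ^+ 2 + 2 * complex.Re (ip H u v) + hnorm v ^+ 2.
Proof.
have -> : hnorm (u + v) ^+ 2 = complex.Re (ip H (u + v) (u + v)) by rewrite ip_hnorm.
rewrite linearDl/= !linearDr/= !ReD !ip_hnorm/= (Re_ipC v u); ring.
Qed.

Lemma Re_ipZl (a : R) u v : complex.Re (ip H (a%:C *: u) v) = a * complex.Re (ip H u v).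
Proof. by rewrite linearZl_LR/=; case: (ip H u v) => p q /=; rewrite mul0r subr0. Qed.

Lemma Re_ip_le u v : complex.Re (ip H u v) <= hnorm u * hnorm v.
Proof.
have [u0|un0] := eqVneq (hnorm u) 0.
  by rewrite u0 mul0r (hnorm_eq0 u0) linear0l.
have [v0|vn0] := eqVneq (hnorm v) 0.
  by rewrite v0 mulr0 (hnorm_eq0 v0) linear0r.
have ugt0 : 0 < hnorm u by rewrite lt_def un0 hnorm_ge0.
have vgt0 : 0 < hnorm v by rewrite lt_def vn0 hnorm_ge0.
(* Cauchy-Schwarz: the square expands to [2 |u| |v| (|u| |v| - Re <u, v>)], and the positive factor
   [|u| |v|] is cancelled. *)
have := sqr_ge0 (hnorm ((hnorm v)%:C *: u + (- hnorm u)%:C *: v)).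
rewrite hnormD_sqr !hnormZ Re_ipZl Re_ipC Re_ipZl Re_ipC normrN !ger0_norm ?hnorm_ge0//.
move=> h; rewrite -subr_ge0 -(pmulr_rge0 _ (mulr_gt0 ugt0 vgt0)); nra.
Qed.

Lemma is_adjoint_sym x y : is_adjoint x y -> is_adjoint y x.
Proof. by move=> xy u v; rewrite ip_conj -xy -ip_conj. Qed.

End HilbertNorm.

(** * Operator norm of bounded operators *)

Section OperatorNorm.
Context {R : realType} {H : hilbert R}.
Implicit Types (u v w : H) (x y : H -> H).

Lemma opnorm_le_cst x (K : R) : 0 <= K ->
  (forall u, hnorm (x u) <= K * hnorm u) -> opnorm x <= K.
Proof.
move=> K0 xK; apply: ge_sup.
  by exists (hnorm (x 0)), 0 => //=; rewrite hnorm0 ler01.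
move=> _ [u /= u1 <-]; apply: (le_trans (xK u)).
by rewrite ler_piMr.
Qed.

Lemma bounded_op_bound x : bounded_op x ->
  exists2 K : R, 0 <= K & forall u, hnorm (x u) <= K * hnorm u.
Proof.
move=> [xlin xcont].
pose L := GRing.isLinear.Build _ _ _ _ x xlin.
pose X : {linear H -> H} := HB.pack x L.
have /linear_boundedP [c [creal cX]] := @continuous_linear_bounded _ _ _ 0 X (xcont 0).
(* [cX] allows any constant of [R[i]] above [c]; [|c| + 1] is one, and being real and nonnegative it
   descends to [R]. *)
have cr : c < `|c| + 1 by rewrite (le_lt_trans (real_ler_norm creal))// ltrDl ltr01.
have [k k0 ck] : exists2 k : R, 0 <= k & `|c| + 1 = k%:C.
  exists (complex.Re (`|c| + 1)); last by rewrite RRe_real// ger0_real// addr_ge0.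
  by rewrite -ler0c RRe_real ?ger0_real ?addr_ge0.
exists k => // u; have -> : k * hnorm u = complex.Re ((`|c| + 1) * `|u|) by rewrite ck normC_hnorm -rmorphM.
by rewrite -lecR RRe_real ?ger0_real ?mulr_ge0 ?addr_ge0// -normC_hnorm; exact: cX.
Qed.

Lemma opnorm_ub x u : bounded_op x -> hnorm u <= 1 -> hnorm (x u) <= opnorm x.
Proof.
move=> /bounded_op_bound[K K0 xK] u1; apply: sup_upper_bound; last by exists u.
split; first by exists (hnorm (x u)), u.
exists K => _ [v /= v1 <-]; apply: (le_trans (xK v)).
by rewrite ler_piMr.
Qed.

Lemma opnorm_ge0 x : bounded_op x -> 0 <= opnorm x.
Proof.
by move=> xB; apply: le_trans (opnorm_ub (u := 0) xB _); rewrite ?hnorm_ge0 ?hnorm0.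
Qed.

Lemma linear_scale x (a : R[i]) u : linear x -> x (a *: u) = a *: x u.
Proof.
move=> xlin; have x0 : x 0 = 0.
  by have := xlin (-1) 0 0; rewrite scaler0 addr0 scaleN1r addNr.
by have := xlin a u 0; rewrite !addr0 x0 addr0.
Qed.

Lemma hnorm_op_le x u : bounded_op x -> hnorm (x u) <= opnorm x * hnorm u.
Proof.
move=> xB; have [u0|un0] := eqVneq (hnorm u) 0.
  have [K _ /(_ u)] := bounded_op_bound xB; rewrite u0 !mulr0//.
have ugt0 : 0 < hnorm u by rewrite lt_def un0 hnorm_ge0.
have : hnorm (x ((hnorm u)^-1%:C *: u)) <= opnorm x.
  by apply: opnorm_ub => //; rewrite hnormZ gtr0_norm ?invr_gt0// mulVf.
rewrite linear_scale; last by case: xB.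
by rewrite hnormZ gtr0_norm ?invr_gt0// mulrC ler_pdivrMr.
Qed.

Lemma opnormD x y : bounded_op x -> bounded_op y ->
  opnorm (x + y) <= opnorm x + opnorm y.
Proof.
move=> xB yB; apply: opnorm_le_cst => [|u]; first by rewrite addr_ge0 ?opnorm_ge0.
by rewrite (le_trans (hnormD _ _))// mulrDl lerD ?hnorm_op_le.
Qed.

(** Only an inequality: on the zero space the identity has norm 0. *)
Lemma opnorm_id_le1 : opnorm (@id H) <= 1.
Proof. by apply: opnorm_le_cst => // u; rewrite mul1r. Qed.

(** Serves to bound a vector by pairing it with itself and cancelling one factor of its norm. *)
Lemma hnorm_sqr_le u (K : R) : 0 <= K ->
  hnorm u ^+ 2 <= K * hnorm u -> hnorm u <= K.
Proof.
move=> K0; rewrite expr2; have [->//|un0] := eqVneq (hnorm u) 0.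
by rewrite ler_pM2r// lt_def un0 hnorm_ge0.
Qed.

(** Cauchy-Schwarz applied to [|y v|^2 = <x (y v), v>]. *)
Lemma opnorm_adjoint_le x y : bounded_op x -> is_adjoint x y -> opnorm y <= opnorm x.
Proof.
move=> xB xy; apply: opnorm_le_cst => [|v]; first exact: opnorm_ge0.
apply: hnorm_sqr_le; first by rewrite mulr_ge0 ?opnorm_ge0 ?hnorm_ge0.
have -> : hnorm (y v) ^+ 2 = complex.Re (ip H (x (y v)) v) by rewrite xy ip_hnorm.
apply: (le_trans (Re_ip_le _ _)); rewrite mulrAC ler_wpM2r ?hnorm_ge0//.
exact: hnorm_op_le.
Qed.

Lemma opnorm_adjoint x y : bounded_op x -> bounded_op y -> is_adjoint x y ->
  opnorm y = opnorm x.
Proof.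
move=> xB yB xy; apply: le_anti.
by rewrite !opnorm_adjoint_le//; exact: is_adjoint_sym.
Qed.

Lemma opnorm_comp_le x y : bounded_op x -> bounded_op y ->
  opnorm (x \o y) <= opnorm x * opnorm y.
Proof.
move=> xB yB; apply: opnorm_le_cst => [|u]; first by rewrite mulr_ge0 ?opnorm_ge0.
rewrite -mulrA (le_trans (hnorm_op_le _ xB))// ler_wpM2l ?opnorm_ge0//.
exact: hnorm_op_le.
Qed.

(* A weak-operator limit inherits the operator-norm bound of its
   approximants. *)
Lemma opnorm_le_approx x (K : R) : bounded_op x -> 0 <= K ->
  (forall u v (e : R), 0 < e -> exists y, [/\ bounded_op y, opnorm (x - y) <= K,
     bounded_op (x - y) & complex.Re (ip H (y u) v) <= e]) ->
  opnorm x <= K.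
Proof.
move=> xB K0 xK; apply: opnorm_le_cst => // u.
apply: hnorm_sqr_le; first by rewrite mulr_ge0 ?hnorm_ge0.
apply/ler_addgt0Pr => e /(xK u (x u))[y [yB xyK xyB ye]].
have -> : hnorm (x u) ^+ 2 =
    complex.Re (ip H ((x - y) u) (x u)) + complex.Re (ip H (y u) (x u)).
  by rewrite -ReD -linearDl/= -[X in ip H X _]/(x u - y u + y u) subrK ip_hnorm.
apply: lerD => //; apply: (le_trans (Re_ip_le _ _)).
rewrite ler_wpM2r ?hnorm_ge0// (le_trans (hnorm_op_le _ xyB))//.
by rewrite ler_wpM2r ?hnorm_ge0.
Qed.

End OperatorNorm.

(** * Closure properties and vector functionals of a von Neumann algebra *)

Lemma cvg_series_head (K : numFieldType) (V : normedModType K) (f : nat -> V) :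
  (forall n, f n.+1 = 0) -> series f @ \oo --> f 0%N.
Proof.
move=> f0; apply: cvg_near_cst; exists 1%N => // -[//|n] _.
by rewrite /series/= big_nat_recl// big1 ?addr0.
Qed.

Section VonNeumann.
Context {R : realType} {H : hilbert R} {M : set (H -> H)}.
Hypothesis vM : von_neumann_algebra M.
Implicit Types (u v : H) (x y : H -> H).

Lemma vn_bounded x : M x -> bounded_op x.
Proof. by case: vM => MB _ _; exact: MB. Qed.

(** Since [M] is its own bicommutant, each closure property below reduces to boundedness and a
    commutation check. *)
Lemma vn_bicommutantP x : bounded_op x ->
  (forall y, commutant M y -> y \o x = x \o y) -> M x.
Proof. by case: vM => _ _ MM xB xy; rewrite -MM; split. Qed.

Lemma vn_id : M id.
Proof.
by apply: vn_bicommutantP => //; split=> [a u v //|u]; exact: cvg_id.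
Qed.

Lemma vn_comp x y : M x -> M y -> M (x \o y).
Proof.
move=> Mx My; have [xlin xcont] := vn_bounded Mx; have [ylin ycont] := vn_bounded My.
apply: vn_bicommutantP => [|z [_ zM]].
  split=> [a u v /=|u]; first by rewrite ylin xlin.
  exact: continuous_comp (ycont u) (xcont (y u)).
by rewrite compA -(zM _ Mx) -compA -(zM _ My).
Qed.

Lemma vn_lin (a : R[i]) x y : M x -> M y -> M (a *: x + y).
Proof.
move=> Mx My; have [xlin xcont] := vn_bounded Mx; have [ylin ycont] := vn_bounded My.
apply: vn_bicommutantP => [|z [[zlin _] zM]].
  split=> [b u v|u].
    change (a *: x (b *: u + v) + y (b *: u + v) =
            b *: (a *: x u + y u) + (a *: x v + y v)).
    by rewrite xlin ylin !scalerDr !scalerA [a * b]mulrC addrACA.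
  change ((fun w => a *: x w + y w) @ u --> a *: x u + y u).
  by apply: cvgD; [apply: cvgZr; exact: xcont | exact: ycont].
apply/funext => u /=.
change (z (a *: x u + y u) = a *: x (z u) + y (z u)).
rewrite zlin; congr (_ *: _ + _).
- by have /(congr1 (@^~ u)) := zM _ Mx.
- by have /(congr1 (@^~ u)) := zM _ My.
Qed.

Lemma vn_sub x y : M x -> M y -> M (x - y).
Proof. by move=> Mx My; rewrite -scaleN1r addrC; exact: vn_lin. Qed.

Lemma vn_add x y : M x -> M y -> M (x + y).
Proof. by move=> Mx My; rewrite -[x]scale1r; exact: vn_lin. Qed.

Lemma vn_adj x : M x -> M (adj x).
Proof. by move=> Mx; case: vM => _ /(_ _ Mx)[y My xy] _; rewrite (adjE xy). Qed.

Lemma vn_adjP x : M x -> is_adjoint x (adj x).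
Proof. by move=> Mx; case: vM => _ /(_ _ Mx)[y My xy] _; rewrite (adjE xy). Qed.

Lemma vn_adjK x : M x -> adj (adj x) = x.
Proof. by move=> Mx; apply/adjE/is_adjoint_sym/vn_adjP. Qed.

Lemma vn_opnorm_adj x : M x -> opnorm (adj x) = opnorm x.
Proof.
move=> Mx; apply: opnorm_adjoint; last exact: vn_adjP.
- exact: vn_bounded.
- exact/vn_bounded/vn_adj.
Qed.

Lemma vn_abs_sq x : M x -> M (abs_sq x).
Proof. by move=> Mx; apply: vn_comp => //; exact: vn_adj. Qed.

Lemma opnorm_abs_sq_le x : M x -> opnorm (abs_sq x) <= opnorm x ^+ 2.
Proof.
move=> Mx; rewrite expr2 -{1}(vn_opnorm_adj Mx).
by apply: opnorm_comp_le; apply/vn_bounded => //; exact: vn_adj.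
Qed.

(** Both sequences are supported at index 0. Weak-* statements thereby apply to matrix
    coefficients. *)
Lemma predual_vector u v : predual M (fun x => ip H (x u) v).
Proof.
pose at0 (w : H) (n : nat) : H := if n is 0 then w else 0.
have at0_cvg w : cvgn (series (fun n => hnorm (at0 w n) ^+ 2)).
  apply/cvg_ex; exists (hnorm w ^+ 2).
  by apply: (@cvg_series_head R R^o (fun n => hnorm (at0 w n) ^+ 2)) => n; rewrite /= hnorm0 expr0n.
exists (at0 u), (at0 v); split=> // x _.
apply: (@cvg_series_head _ R[i]^o (fun n => ip H (x (at0 u n)) (at0 v n))) => n /=.
by rewrite linear0r.
Qed.

End VonNeumann.

(** * Kadison-Schwarz inequality for 2-positive maps *)

Section KadisonSchwarz.
Context {R : realType} {H : hilbert R} {M : set (H -> H)}.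
Hypothesis vM : von_neumann_algebra M.
Implicit Types (u v w : H) (x y a b c d : H -> H).

Definition op_mx2 a b c d : 'M[H -> H]_2 :=
  \matrix_(i, j) if i == 0 then (if j == 0 then a else b)
                 else (if j == 0 then c else d).

Lemma positive_op_mx2 a b c d : positive_mx (op_mx2 a b c d) <->
  forall v w, 0 <= ip H (a v) v + ip H (b w) v + (ip H (c v) w + ip H (d w) w).
Proof.
split=> [P v w|P u].
  have := P (fun i => if i == 0 then v else w).
  by rewrite !big_ord_recl !big_ord0 !addr0 !mxE.
have := P (u ord0) (u (lift ord0 ord0)).
by rewrite !big_ord_recl !big_ord0 !addr0 !mxE.
Qed.

Lemma map_op_mx2 (S : (H -> H) -> (H -> H)) a b c d :
  map_mx S (op_mx2 a b c d) = op_mx2 (S a) (S b) (S c) (S d).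
Proof. by apply/matrixP => i j; rewrite !mxE; do 2!case: eqP. Qed.

Variable S : (H -> H) -> (H -> H).
Hypothesis S_M : forall x, M x -> M (S x).
Hypothesis S_pos : npositive M 2 S.

(** The matrix with rows [(id, x)] and [(y, y \o x)] is positive because its form is [|v + x w|^2];
    2-positivity carries this over to its entrywise image. *)
Lemma npositive2_gram x y : M x -> M y -> is_adjoint x y -> forall v w,
  0 <= ip H (S id v) v + ip H (S x w) v + (ip H (S y v) w + ip H (S (y \o x) w) w).
Proof.
move=> Mx My xy; apply/positive_op_mx2; rewrite -map_op_mx2; apply: S_pos.
  by move=> i j; rewrite mxE; do 2!case: eqP => _ //; [exact: vn_id | exact: vn_comp].
apply/positive_op_mx2 => v w /=; have yx := is_adjoint_sym xy.
have -> : ip H v v + ip H (x w) v + (ip H (y v) w + ip H (y (x w)) w) =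
    ip H (v + x w) (v + x w).
  by rewrite linearDl/= !linearDr/= !yx [RHS]addrACA.
by rewrite ip_hnorm ler0c sqr_ge0.
Qed.

(** Setting one of the two vectors to 0 in the form isolates a diagonal entry. *)
Lemma npositive2_diag x y : M x -> M y -> is_adjoint x y ->
  (forall v, 0 <= ip H (S id v) v) /\ (forall w, 0 <= ip H (S (y \o x) w) w).
Proof.
move=> Mx My xy; have P := npositive2_gram Mx My xy.
have S0 z : M z -> S z 0 = 0.
  by move=> /S_M/(vn_bounded vM)[zlin _]; rewrite -(scale0r 0) linear_scale// !scale0r.
split=> [v|w].
- by have := P v 0; rewrite (S0 _ Mx) (S0 _ (vn_comp vM My Mx)) !(linear0l, linear0r) !addr0.
- by have := P 0 w; rewrite (S0 _ My) (S0 _ (vn_id vM)) !(linear0l, linear0r) !add0r.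
Qed.

(* The positive 2x2 form is real, hence so is its off-diagonal part; its values
   at [w] and [i w] then give the adjoint relation. *)
Lemma npositive2_adjoint x y : M x -> M y -> is_adjoint x y -> is_adjoint (S x) (S y).
Proof.
move=> Mx My xy w v; have P := npositive2_gram Mx My xy.
have [P1 P2] := npositive2_diag Mx My xy.
have off v' w' : complex.Im (ip H (S x w') v') + complex.Im (ip H (S y v') w') = 0.
  move: (ger0_Im (P v' w')) (ger0_Im (P1 v')) (ger0_Im (P2 w')).
  case: (ip H (S id v') v') => ? ?; case: (ip H (S (y \o x) w') w') => ? ?.
  case: (ip H (S x w') v') => ? ?; case: (ip H (S y v') w') => ? ? /=; lra.
have [Sxlin _] := vn_bounded vM (S_M Mx).
have := off v w; have := off v ('i%C *: w).
rewrite linear_scale// linearZl_LR linearZr_LR/= (ip_conj w (S y v)).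
case: (ip H (S x w) v) => p q; case: (ip H (S y v) w) => p' q' /=.
rewrite !mul0r !mul1r => h1 h2; congr Complex; lra.
Qed.

Hypothesis S_id : opnorm (S id) <= 1.

(** Norm form of the operator inequality [|S x|^2 <= S |x|^2], which rests on [S id] having norm at
    most 1. *)
Lemma kadison_schwarz x : M x -> opnorm (S x) ^+ 2 <= opnorm (S (abs_sq x)).
Proof.
move=> Mx; have My := vn_adj vM Mx; have xy := vn_adjP vM Mx.
have SxB := vn_bounded vM (S_M Mx); have Sxy := npositive2_adjoint Mx My xy.
have SaB := vn_bounded vM (S_M (vn_abs_sq vM Mx)).
have SiB := vn_bounded vM (S_M (vn_id vM)).
have [P1 P2] := npositive2_diag Mx My xy.
set K := opnorm (S (abs_sq x)); have K0 : 0 <= K by exact: opnorm_ge0.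
suff : opnorm (S x) <= Num.sqrt K.
  by move=> h; rewrite -(sqr_sqrtr K0) ler_pXn2r// nnegrE ?sqrtr_ge0 ?opnorm_ge0.
apply: opnorm_le_cst => [|u]; first exact: sqrtr_ge0.
rewrite -(@ler_pXn2r _ 2)// ?nnegrE ?mulr_ge0 ?sqrtr_ge0 ?hnorm_ge0//.
rewrite exprMn sqr_sqrtr//.
(* The test vector [v = - S x u] makes both off-diagonal terms [- |S x u|^2]. The [S id] term is at
   most [|S x u|^2], which leaves [|S x u|^2 <= <S (abs_sq x) u, u>]. *)
have := npositive2_gram Mx My xy (- S x u) u; rewrite -/(abs_sq x).
have -> : ip H (S (adj x) (- S x u)) u = - (hnorm (S x u) ^+ 2)%:C.
  by rewrite (is_adjoint_sym Sxy) linearNl/= ip_hnorm.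
rewrite (linearNr (ip H) (S x u))/= ip_hnorm.
have : complex.Re (ip H (S id (- S x u)) (- S x u)) <= hnorm (S x u) ^+ 2.
  apply: (le_trans (Re_ip_le _ _)).
  have hN : hnorm (- S x u) = hnorm (S x u) by rewrite /hnorm normrN.
  rewrite hN expr2 ler_wpM2r ?hnorm_ge0// (le_trans (hnorm_op_le _ SiB))// hN.
  by rewrite ler_piMl ?hnorm_ge0.
have : complex.Re (ip H (S (abs_sq x) u) u) <= K * hnorm u ^+ 2.
  apply: (le_trans (Re_ip_le _ _)).
  by rewrite expr2 mulrA ler_wpM2r ?hnorm_ge0// hnorm_op_le.
case: (ip H (S (abs_sq x) u) u) => ? ?.
case: (ip H (S id (- S x u)) (- S x u)) => ? ? /=.
rewrite lecE/= => h1 h2 /andP[_]; lra.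
Qed.

End KadisonSchwarz.

(** * Powers of [I - S] and [I + S] for a linear contraction [S] of [M] *)

Section Contraction.
Context {R : realType} {H : hilbert R} {M : set (H -> H)}.
Hypothesis vM : von_neumann_algebra M.
Variable S : (H -> H) -> (H -> H).
Hypothesis S_lin : endo_linear M S.
Implicit Types (x y : H -> H).

Lemma endo_sub x y : M x -> M y -> S (x - y) = S x - S y.
Proof.
move=> Mx My; have [_ Slin] := S_lin.
by rewrite addrC -scaleN1r Slin// scaleN1r addrC.
Qed.

Lemma endo_add x y : M x -> M y -> S (x + y) = S x + S y.
Proof. by move=> Mx My; have [_ Slin] := S_lin; rewrite -{1}[x]scale1r Slin// scale1r. Qed.

Lemma iter_stable (F : (H -> H) -> (H -> H)) k x :
  (forall y, M y -> M (F y)) -> M x -> M (iter k F x).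
Proof. by move=> FM Mx; elim: k => //= k; exact: FM. Qed.

Lemma diff_stable x : M x -> M (x - S x).
Proof. by move=> Mx; apply: vn_sub => //; exact: S_lin.1. Qed.

Lemma sum_stable x : M x -> M (x + S x).
Proof. by move=> Mx; apply: vn_add => //; exact: S_lin.1. Qed.

Lemma iter_diff_sub k x y : M x -> M y ->
  iter k (fun z => z - S z) (x - y) =
  iter k (fun z => z - S z) x - iter k (fun z => z - S z) y.
Proof.
move=> Mx My; elim: k => //= k ->.
rewrite endo_sub; try by apply: iter_stable => //; exact: diff_stable.
by rewrite !opprB addrACA [RHS]addrACA [X in _ + X = _]addrC.
Qed.

(** [I - S^2 = (I + S)(I - S)] with commuting factors, so powers split. [S2] is a separate map
    because it need agree with [S^2] on [M] only. *)
Lemma iter_diff_sqr (S2 : (H -> H) -> (H -> H)) k x :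
  (forall y, M y -> S2 y = S (S y)) -> M x ->
  iter k (fun y => y - S2 y) x =
  iter k (fun y => y + S y) (iter k (fun y => y - S y) x).
Proof.
move=> S2E Mx.
have MD j y : M y -> M (iter j (fun y => y - S y) y).
  by move=> My; apply: iter_stable => //; exact: diff_stable.
have ME j y : M y -> M (iter j (fun y => y + S y) y).
  by move=> My; apply: iter_stable => //; exact: sum_stable.
have comm y : M y -> y + S y - S (y + S y) = (y - S y) + S (y - S y).
  move=> My; have MSy := S_lin.1 _ My.
  by rewrite endo_add// endo_sub// opprD !addrA addrK subrK.
have commn j y : M y -> iter j (fun y => y + S y) y - S (iter j (fun y => y + S y) y) =
    iter j (fun y => y + S y) (y - S y).
  by move=> My; elim: j => //= j IH; rewrite comm ?IH//; exact: ME.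
elim: k => //= k ->; set y := iter k _ x.
have My : M y by exact: MD.
rewrite S2E; last exact: ME.
set z := iter k _ y; have Mz : M z by exact: ME.
by rewrite -commn// -/z -comm// endo_add //; [rewrite opprD addrA addrK | exact: S_lin.1].
Qed.

Hypothesis S_contr : forall x, M x -> opnorm (S x) <= opnorm x.

(** Every term of [(I + S)^k - I] contains a factor [S], so [||S x||] suffices on the right. Writing
    [(I + S) y - x] as [(y - x) + S (y - x) + S x] gives the recursion [c -> 2 c + 1], solved by
    [2^k - 1]. *)
Lemma opnorm_iter_sum_sub k x : M x ->
  opnorm (iter k (fun y => y + S y) x - x) <= (2 ^+ k - 1) * opnorm (S x).
Proof.
move=> Mx; elim: k => [|k IH] /=.
  by rewrite subrr expr0 subrr mul0r; apply: opnorm_le_cst => // u; rewrite mul0r hnorm0.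
set y := iter k _ x in IH *.
have My : M y by apply: iter_stable => // ?; exact: sum_stable.
have Myx := vn_sub vM My Mx; have MSyx := S_lin.1 _ Myx; have MSx := S_lin.1 _ Mx.
have -> : y + S y - x = (y - x) + (S (y - x) + S x).
  by rewrite endo_sub// subrK addrAC.
have bnd := vn_bounded vM.
apply: le_trans (opnormD (bnd _ Myx) (bnd _ (vn_add vM MSyx MSx))) _.
apply: le_trans (lerD (lexx _) (opnormD (bnd _ MSyx) (bnd _ MSx))) _.
have := S_contr Myx; rewrite exprS; lra.
Qed.

End Contraction.

(** * Dyadic telescoping and weak limits for the semigroup *)

Lemma powR_half_lt1 (R : realType) (a : R) : 0 < a -> 2^-1 `^ a < 1.
Proof.
move=> a0; have {2}<- : 1 `^ a = 1 :> R by rewrite powR1.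
by apply: gt0_ltr_powR => //=; rewrite ?nnegrE//; lra.
Qed.

Section Semigroup.
Context {R : realType} {H : hilbert R} {M : set (H -> H)}.
Variable T : R -> (H -> H) -> (H -> H).
Hypothesis vM : von_neumann_algebra M.
Hypothesis sT : op_semigroup M T.
Hypothesis pT : two_positive_contractive M T.
Implicit Types (s t alpha : R) (f x : H -> H) (u v : H).

Local Notation diff s := (fun x => x - T s x).

Lemma semigroup_endo s : 0 < s -> endo_linear M (T s).
Proof. by case: sT => h _ _; exact: h. Qed.

Lemma iter_diff_stable k s f : 0 < s -> M f -> M (iter k (diff s) f).
Proof.
by move=> s0 Mf; apply: iter_stable => // x; exact: (diff_stable vM (semigroup_endo s0)).
Qed.

(** With [S = T (s / 2)], the power at scale [s] is [(I + S)^k] applied to the power at scale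
    [s / 2]; the constant [2^k - 1] is relaxed to [2^k]. *)
Lemma opnorm_diff_halve k s f : 0 < s -> M f ->
  opnorm (iter k (diff s) f - iter k (diff (s / 2)) f) <=
  2 ^+ k * opnorm (T (s / 2) (iter k (diff (s / 2)) f)).
Proof.
move=> s0 Mf; have h0 : 0 < s / 2 by rewrite divr_gt0.
have hE := semigroup_endo h0; case: sT pT => _ _ TT [_ Tc _].
have Mk := iter_diff_stable k h0 Mf.
rewrite (@iter_diff_sqr _ _ _ vM _ hE (T s))//; last first.
  by move=> y My; rewrite TT// -splitr.
rewrite (le_trans (opnorm_iter_sum_sub vM hE _ _ Mk))//; first by move=> x; exact: Tc.
by rewrite ler_wpM2r ?gerBl// opnorm_ge0//; exact/(vn_bounded vM)/hE.1.
Qed.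

Lemma iter_semigroup m s f : 0 < s -> M f -> iter m.+1 (T s) f = T (s *+ m.+1) f.
Proof.
move=> s0 Mf; case: sT => _ _ TT; elim: m => [|m IH]; first by rewrite mulr1n.
by rewrite iterS IH TT// ?pmulrn_lgt0// -mulrS.
Qed.

(** The extra factor [T^m] makes the induction on [k] work: [D^(k+1) T^m f = D^k T^m f - D^k T^(m+1)
    f], and the limits of the two terms do not depend on [m], hence cancel. *)
Lemma cvg_iter_diff_weak k m (h : nat -> R) f u v : M f ->
  (forall n, 0 < h n) -> h @ \oo --> 0 ->
  (fun n => ip H (iter k (diff (h n)) (iter m (T (h n)) f) u) v : R[i]^o) @ \oo -->
  (if k is 0 then ip H (f u) v else 0 : R[i]^o).
Proof.
move=> Mf h0 hcvg; elim: k m => [m|k IH m] /=.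
  case: m => [|m] /=; first exact: cvg_cst.
  case: pT => _ _ /(_ _ _ Mf (predual_vector u v)) wT.
  under eq_fun do rewrite -iterS iter_semigroup//.
  apply: (cvg_comp _ _ _ wT) => U /= [e e0 eU].
  have /cvgr0Pnorm_lt/(_ _ e0) : h n *+ m.+1 @[n --> \oo] --> 0.
    by rewrite -(mul0rn _ m.+1); apply: cvgMn.
  apply: filterS => n; rewrite /= => hn; apply: eU => /=; last by rewrite pmulrn_lgt0.
  by rewrite sub0r normrN.
pose a m n := ip H (iter k (diff (h n)) (iter m (T (h n)) f) u) v : R[i]^o.
have aE n : ip H (iter k.+1 (diff (h n)) (iter m (T (h n)) f) u) v = a m n - a m.+1 n.
  rewrite iterSr -linearBl/=; congr (ip H _ v).
  have hE := semigroup_endo (h0 n).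
  have Mm j : M (iter j (T (h n)) f) by apply: iter_stable => //; exact: hE.1.
  by rewrite (iter_diff_sub vM hE _ (Mm m) (Mm m.+1)).
have -> : (0 : R[i]^o) = (if k is 0 then ip H (f u) v else 0) - (if k is 0 then ip H (f u) v else 0).
  by rewrite subrr.
under eq_fun do rewrite aE.
exact: cvgB (IH m) (IH m.+1).
Qed.

(** The geometric sum is bounded by a telescoping difference of powers, a form that passes through
    the induction on [n]. *)
Lemma opnorm_iter_diff_dyadic k t alpha (A : R) f : 0 < t -> 0 < alpha -> 0 <= A -> M f ->
  (forall s, 0 < s -> opnorm (T s (iter k (diff s) f)) <= A * s `^ alpha) ->
  forall n, opnorm (iter k (diff t) f - iter k (diff (t / 2 ^+ n)) f) <=
  2 ^+ k / (1 - 2^-1 `^ alpha) * A * (t `^ alpha - (t / 2 ^+ n) `^ alpha).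
Proof.
move=> t0 a0 A0 Mf TA; set r := 2^-1 `^ alpha.
have r1 : 0 < 1 - r.
  by rewrite subr_gt0 /r powR_half_lt1.
elim=> [|n IH].
  by rewrite expr0 divr1 !subrr mulr0; apply: opnorm_le_cst => // u; rewrite mul0r hnorm0.
have s0 : 0 < t / 2 ^+ n by rewrite divr_gt0 ?exprn_gt0.
set s := t / 2 ^+ n in s0 IH *.
have -> : t / 2 ^+ n.+1 = s / 2 by rewrite exprS invfM mulrA mulrAC.
have Md q : 0 < q -> M (iter k (diff q) f) by move=> q0; exact: iter_diff_stable.
have h0 : 0 < s / 2 by rewrite divr_gt0.
have bnd x y : M x -> M y -> bounded_op (x - y) by move=> Mx My; exact/(vn_bounded vM)/vn_sub.
rewrite -(subrKA (iter k (diff s) f)).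
apply: le_trans (opnormD (bnd _ _ (Md _ t0) (Md _ s0)) (bnd _ _ (Md _ s0) (Md _ h0))) _.
apply: le_trans (lerD IH (opnorm_diff_halve k s0 Mf)) _.
have sh : (s / 2) `^ alpha = s `^ alpha * r by rewrite powRM ?invr_ge0// ltW.
apply: le_trans (lerD (lexx _) (ler_wpM2l _ (TA _ h0))) _; first by rewrite exprn_ge0.
rewrite sh -subr_ge0.
(* Passing from [s] to [s / 2] raises the bound by [2^k A s^alpha], while the new term costs only
   [r] times that; the right side is the slack. *)
have -> : 2 ^+ k / (1 - r) * A * (t `^ alpha - s `^ alpha * r) -
    (2 ^+ k / (1 - r) * A * (t `^ alpha - s `^ alpha) + 2 ^+ k * (A * (s `^ alpha * r))) =
    2 ^+ k * A * s `^ alpha * (1 - r).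
  by field; rewrite gt_eqF.
by rewrite !mulr_ge0 ?exprn_ge0 ?powR_ge0// ltW.
Qed.

(** Limit of the dyadic bound: the subtracted power at scale [t / 2^n] tends weakly to 0, its
    exponent [k.+1] being positive, and operator-norm bounds survive weak limits. *)
Lemma opnorm_iter_diff_le k t alpha (A : R) f : 0 < t -> 0 < alpha -> 0 <= A -> M f ->
  (forall s, 0 < s -> opnorm (T s (iter k.+1 (diff s) f)) <= A * s `^ alpha) ->
  opnorm (iter k.+1 (diff t) f) <=
  2 ^+ k.+1 / (1 - 2^-1 `^ alpha) * A * t `^ alpha.
Proof.
move=> t0 a0 A0 Mf TA.
have r1 : 0 < 1 - 2^-1 `^ alpha.
  by rewrite subr_gt0 powR_half_lt1.
have c0 : 0 <= 2 ^+ k.+1 / (1 - 2^-1 `^ alpha) * A.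
  by rewrite mulr_ge0 ?divr_ge0 ?exprn_ge0// ltW.
pose h n := t / 2 ^+ n; have h0 n : 0 < h n by rewrite divr_gt0 ?exprn_gt0.
have Md q : 0 < q -> M (iter k.+1 (diff q) f) by move=> q0; exact: iter_diff_stable.
have hcvg : h @ \oo --> 0.
  rewrite /h -(mulr0 t); apply: cvgMr.
  by under eq_fun do rewrite -exprVn; apply: cvg_expr; rewrite ger0_norm//; lra.
apply: opnorm_le_approx => [||u v e e0].
- exact/(vn_bounded vM)/Md.
- by rewrite mulr_ge0 ?powR_ge0.
have /cvgr0Pnorm_le/(_ e%:C) := @cvg_iter_diff_weak k.+1 0 h f u v Mf h0 hcvg.
rewrite ltcR => /(_ e0)[n _ /(_ n (leqnn n)) /= le_e].
exists (iter k.+1 (diff (h n)) f); split.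
- exact/(vn_bounded vM)/Md.
- apply: le_trans (opnorm_iter_diff_dyadic t0 a0 A0 Mf TA n) _.
  by rewrite ler_wpM2l// gerBl powR_ge0.
- by apply/(vn_bounded vM)/vn_sub => //; exact: Md.
- by move: le_e; rewrite -lecR; apply: le_trans; apply: le_trans (normc_ge_Re _); rewrite lecR ler_norm.
Qed.

End Semigroup.

(** * Comparison of the column and row norms *)

Section CampanatoNorm.
Context {R : realType} {H : hilbert R} {M : set (H -> H)}.
Variables (T : R -> (H -> H) -> (H -> H)) (alpha : R).
Hypothesis vM : von_neumann_algebra M.
Hypothesis sT : op_semigroup M T.
Hypothesis pT : two_positive_contractive M T.
Hypothesis alpha0 : 0 < alpha.
Implicit Types (s t : R) (f x y : H -> H).

Local Notation diff s := (fun x => x - T s x).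
Local Notation order := (Num.truncn alpha).+1.

(** 2-positivity makes [T t] commute with adjoints, hence also [I - T t] and its powers. *)
Lemma iter_diff_adj k t f : 0 < t -> M f ->
  iter k (diff t) (adj f) = adj (iter k (diff t) f).
Proof.
move=> t0 Mf; symmetry; apply: adjE.
have tE := semigroup_endo sT t0; case: pT => /(_ _ t0) tP _ _.
elim: k => [|k IH] /=; first exact: (vn_adjP vM).
have Mk := iter_diff_stable vM sT k t0 Mf.
have Mka := iter_diff_stable vM sT k t0 (vn_adj vM Mf).
have IHT := npositive2_adjoint vM tE.1 tP Mk Mka IH.
move=> u v; set x := iter k _ f in IH IHT *; set y := iter k _ (adj f) in IH IHT *.
change (ip H (x u - T t x u) v = ip H u (y v - T t y v)).
by rewrite linearBl/= linearBr/= IH IHT.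
Qed.

Lemma campanato_osc_ge0 t f : 0 <= campanato_osc T alpha t f.
Proof. by rewrite mulr_ge0 ?invr_ge0 ?powR_ge0 ?sqrtr_ge0. Qed.

(** Contractivity of [T t] together with [||x^* x|| <= ||x||^2]. *)
Lemma campanato_osc_le t f : 0 < t -> M f ->
  campanato_osc T alpha t f <= (t `^ alpha)^-1 * opnorm (iter order (diff t) f).
Proof.
move=> t0 Mf; rewrite ler_wpM2l ?invr_ge0 ?powR_ge0//.
have Mk := iter_diff_stable vM sT order t0 Mf; case: pT => _ Tc _.
have xB := vn_bounded vM Mk; rewrite -[leRHS]ger0_norm ?opnorm_ge0// -sqrtr_sqr.
rewrite ler_wsqrtr// (le_trans (Tc _ _ t0 (vn_abs_sq vM Mk)))//.
exact: (opnorm_abs_sq_le vM).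
Qed.

(** Kadison-Schwarz under the square root, with the weight [s^alpha] moved across. *)
Lemma opnorm_semigroup_diff_le s f : 0 < s -> M f ->
  opnorm (T s (iter order (diff s) f)) <= campanato_osc T alpha s f * s `^ alpha.
Proof.
move=> s0 Mf; have Mk := iter_diff_stable vM sT order s0 Mf.
have sE := semigroup_endo sT s0; case: pT => /(_ _ s0) sP Tc _.
rewrite /campanato_osc mulrAC mulVf ?gt_eqF ?powR_gt0// mul1r.
rewrite -[leLHS]ger0_norm; last exact/opnorm_ge0/(vn_bounded vM)/sE.1.
rewrite -sqrtr_sqr ler_wsqrtr//; apply: (kadison_schwarz vM sE.1 sP) => //.
exact: le_trans (Tc _ _ s0 (vn_id vM)) opnorm_id_le1.
Qed.

(** The constant of [opnorm_iter_diff_le] at order [[alpha] + 1]. *)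
Definition campanato_const : R := 2 ^+ order / (1 - 2^-1 `^ alpha).

(** Lets the same constant absorb the summand [opnorm f] of the norms. *)
Lemma campanato_const_ge1 : 1 <= campanato_const.
Proof.
have r1 := powR_half_lt1 alpha0.
rewrite ler_pdivlMr ?subr_gt0// mul1r (@le_trans _ _ 1)// ?gerBl ?powR_ge0//.
by rewrite exprn_ege1// ler1n.
Qed.

(** The oscillation of [adj f] is at most [t^-alpha ||D_t^k (adj f)||], which equals
    [t^-alpha ||D_t^k f||], and the latter is controlled by the column oscillation of [f]. *)
Lemma campanato_osc_adj_le (A : R) t f : 0 < t -> M f ->
  (forall s, 0 < s -> campanato_osc T alpha s f <= A) ->
  campanato_osc T alpha t (adj f) <= campanato_const * A.
Proof.
move=> t0 Mf fA; have A0 : 0 <= A by rewrite (le_trans (campanato_osc_ge0 1 f))// fA.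
apply: (le_trans (campanato_osc_le t0 (vn_adj vM Mf))).
have Mk := iter_diff_stable vM sT order t0 Mf.
rewrite iter_diff_adj// (vn_opnorm_adj vM Mk) mulrC ler_pdivrMr ?powR_gt0//.
apply: (opnorm_iter_diff_le vM sT pT) => // s s0.
by rewrite (le_trans (opnorm_semigroup_diff_le s0 Mf))// ler_wpM2r ?powR_ge0// fA.
Qed.

Local Open Scope ereal_scope.

Lemma campanato_osc_le_sup t f : (0 < t)%R -> (campanato_osc T alpha t f)%:E <=
  ereal_sup [set (campanato_osc T alpha s f)%:E | s in [set s | (0 < s)%R]].
Proof. by move=> t0; apply: ereal_sup_ubound; exists t. Qed.

Lemma col_norm_ge0 f : M f -> 0 <= col_norm T alpha f.
Proof.
move=> Mf; rewrite adde_ge0// ?lee_fin ?opnorm_ge0//; first exact: (vn_bounded vM).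
by rewrite (le_trans _ (campanato_osc_le_sup _ ltr01))// lee_fin campanato_osc_ge0.
Qed.

Lemma row_norm_ge0 f : M f -> 0 <= row_norm T alpha f.
Proof. by move=> Mf; apply/col_norm_ge0/(vn_adj vM). Qed.

(** Stated on all of [M] with extended real values, so that it yields both an inclusion of spaces
    and a norm estimate. *)
Lemma row_norm_le_col_norm f : M f ->
  row_norm T alpha f <= campanato_const%:E * col_norm T alpha f.
Proof.
move=> Mf; rewrite /row_norm /col_norm (vn_opnorm_adj vM Mf).
have := @campanato_osc_le_sup ^~ f; set S := ereal_sup [set _%:E | _ in _] => Sub.
have C1 := campanato_const_ge1; have C0 := lt_le_trans ltr01 C1.
(* An infinite supremum makes the right side [+oo]; the value [-oo] is excluded by the oscillation
   at time 1. *)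
case: S Sub => [A| |] fA.
- have -> : campanato_const%:E * ((opnorm f)%:E + A%:E) =
      (campanato_const * opnorm f)%:E + (campanato_const * A)%:E.
    by rewrite -EFinD -EFinM mulrDr.
  apply: leeD.
    by rewrite lee_fin ler_peMl// opnorm_ge0//; exact: (vn_bounded vM).
  by apply: ge_ereal_sup => _ [t t0 <-]; rewrite lee_fin campanato_osc_adj_le//.
- have -> : (opnorm f)%:E + +oo = +oo by [].
  by rewrite gt0_muley ?lte_fin// leey.
- by have := fA _ ltr01; rewrite leeNy_eq.
Qed.

Lemma col_norm_le_row_norm f : M f ->
  col_norm T alpha f <= campanato_const%:E * row_norm T alpha f.
Proof.
move=> Mf; rewrite -{1}(vn_adjK vM Mf); exact/row_norm_le_col_norm/(vn_adj vM).
Qed.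

End CampanatoNorm.

(** * Equivalence of norms from one-sided bounds *)

Section EquivalentNorms.
Context {R : realType} {H : hilbert R} {D : set (H -> H)}.
Local Open Scope ereal_scope.

Lemma equivalent_normsI (N1 N2 : (H -> H) -> \bar R) (C : R) : (0 < C)%R ->
  (forall f, D f -> N1 f <= C%:E * N2 f) -> (forall f, D f -> N2 f <= C%:E * N1 f) ->
  equivalent_norms D N1 N2.
Proof.
move=> C0 N12 N21; exists C^-1%R, C; split; rewrite ?invr_gt0// => f Df.
split; last exact: N21.
by rewrite muleC lee_pdivrMr// muleC N12.
Qed.

Lemma equivalent_norms_max (N1 N2 : (H -> H) -> \bar R) (C : R) : (1 <= C)%R ->
  (forall f, D f -> 0 <= N1 f) -> (forall f, D f -> N2 f <= C%:E * N1 f) ->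
  equivalent_norms D N1 (fun f => maxe (N1 f) (N2 f)).
Proof.
move=> C1 N1_ge0 N21; exists 1%R, C; split; rewrite ?ltr01 ?(lt_le_trans ltr01 C1)// => f Df.
rewrite mul1e le_max lexx ge_max N21// andbT; split=> //.
by rewrite -[leLHS]mul1e lee_wpmul2r ?N1_ge0 ?lee_fin.
Qed.

End EquivalentNorms.

(** * Equality of the three spaces and equivalence of their norms *)

Theorem corollary1p2 (R : realType) (H : hilbert R) (M : set (H -> H))
    (T : R -> (H -> H) -> (H -> H)) (alpha : R) :
  von_neumann_algebra M ->
  op_semigroup M T ->
  two_positive_contractive M T ->
  analytic_semigroup M T ->
  0 < alpha ->
  [/\ col_space M T alpha = row_space M T alpha,
      row_space M T alpha = mix_space M T alpha,
      equivalent_norms (mix_space M T alpha)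
        (col_norm T alpha) (row_norm T alpha),
      equivalent_norms (mix_space M T alpha)
        (row_norm T alpha) (mix_norm T alpha) &
      equivalent_norms (mix_space M T alpha)
        (col_norm T alpha) (mix_norm T alpha)].
Proof.
move=> vM sT pT _ alpha0.
have C1 := campanato_const_ge1 alpha0; have C0 := lt_le_trans ltr01 C1.
have rowC f : M f -> _ := @row_norm_le_col_norm _ _ _ _ _ vM sT pT alpha0 f.
have colC f : M f -> _ := @col_norm_le_row_norm _ _ _ _ _ vM sT pT alpha0 f.
(* Finiteness passes from one norm to the other, which gives both inclusions between the column and
   row spaces. *)
have fin (x y : \bar R) : (0 <= y -> x <= (campanato_const alpha)%:E * y -> y < +oo -> x < +oo)%E.
  move=> y0 xy yoo; apply: le_lt_trans xy _.
  by rewrite lte_mul_pinfty// lee_fin ltW.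
have eq_space : col_space M T alpha = row_space M T alpha.
  apply/seteqP; split=> [f [Mf fC]|f [Mf [_ fC]]]; split=> //.
    split; first exact: vn_adj.
    by apply: fin fC; [exact: (col_norm_ge0 _ _ vM) | exact: rowC].
  by apply: fin fC; [exact: (row_norm_ge0 _ _ vM) | exact: colC].
have MD f : mix_space M T alpha f -> M f by case=> -[].
split=> //.
- by rewrite /mix_space eq_space setIid.
- by apply: (equivalent_normsI C0) => f /MD; [exact: colC | exact: rowC].
(* The maximum is symmetric, so the row norm can take the place of the first norm. *)
- have -> : mix_norm T alpha = fun f => maxe (row_norm T alpha f) (col_norm T alpha f).
    by apply/funext => f; rewrite /mix_norm maxC.
  by apply: (equivalent_norms_max C1) => f /MD; [exact: (row_norm_ge0 _ _ vM) | exact: colC].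
- by apply: (equivalent_norms_max C1) => f /MD; [exact: (col_norm_ge0 _ _ vM) | exact: rowC].
Qed.
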